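(* For a given $n$-tuple of integers $\{a_1,a_2,\dots,a_n\}$ with $0\le a_1\le a_2\le\cdots\le a_n$, there exists a rooted tree $T$ such that $D(T)=\{a_1,a_2,\dots,a_n\}$ (equality of multisets) if and only if $$\frac{[a_n]_q!}{\prod_{i=1}^{n-1}[a_i+1]_q}$$ can be written as the product of some $q$-binomial coefficients.
   Context: Rooted trees are finite. For a vertex $v$ of a rooted tree $T$, $d(v)$ denotes the number of descendants of $v$ ($v$ itself not counted), and $D(T)$ denotes the multiset $\{d(v)\mid v\in V(T)\}$, where $V(T)$ is the vertex set of $T$. Notation: $[m]_q=\frac{1-q^m}{1-q}$, $[m]_q!=\prod_{i=1}^m[i]_q$ (with $[0]_q!=1$), and the $q$-binomial coefficients are $\binom{m+k}{m,k}_q=\frac{[m+k]_q!}{[m]_q!\,[k]_q!}$ for non-negative integers $m,k$.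
   Formalization: The condition a_n = n-1 (which holds for every tree with n vertices) is added to the q-binomial side; without it the claim fails, e.g. for (0,2) the quotient is [2]_q, a q-binomial coefficient, but no rooted tree has D(T) = {0,2}. *)

(* Defs.v *)
From mathcomp Require Import all_boot all_order all_algebra.

Set Implicit Arguments.
Unset Strict Implicit.
Unset Printing Implicit Defensive.

Import GRing.Theory.

(* A finite rooted tree is given by its parent map: each vertex is led to the
   root by iterating [parent].  The root has no parent; by convention [parent]
   fixes it (and then it fixes no other vertex). *)
Record rtree := RTree {
  vertex : finType;
  root : vertex;
  parent : vertex -> vertex;
  parent_root : parent root = root;
  parent_connect : forall v : vertex, fconnect parent v root
}.

(* [fconnect f w v] means that v is an iterate of f at w. *)
Definition descendants (T : rtree) (v : vertex T) : {set vertex T} :=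
  [set w | (w != v) && fconnect (@parent T) w v].

(* The multiset D(T), as a sequence to be compared up to [perm_eq]. *)
Definition descendant_counts (T : rtree) : seq nat :=
  [seq #|descendants v| | v : vertex T].

Local Open Scope ring_scope.

(* The field Q(q) of rational functions in the indeterminate q. *)
Definition ratfun := {fraction {poly rat}}.

Definition q : ratfun := tofrac ('X : {poly rat}).

Definition qnum (m : nat) : ratfun := (1 - q ^+ m) / (1 - q).

Definition qfact (m : nat) : ratfun := \prod_(1 <= i < m.+1) qnum i.

Definition qbinom (m k : nat) : ratfun :=
  qfact (m + k) / (qfact m * qfact k).

(* The empty product is allowed; it equals [qbinom 0 0] = 1 anyway. *)
Definition is_qbinom_product (x : ratfun) : Prop :=
  exists s : seq (nat * nat), x = \prod_(mk <- s) qbinom mk.1 mk.2.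

(* Main.v *)
(* If the subtrees hanging from a vertex have sizes s_1, ..., s_k, then
   [s_1 + ... + s_k]! is a product of q-binomials times [s_1]! ... [s_k]!, and
   [s_i]! / [s_i] = [s_i - 1]!; recursively, this makes the quotient of a tree
   a product of q-binomials.

   Conversely, the [m] with m >= 2 are multiplicatively independent, because
   a primitive m-th root of unity is a root of [k] only if m divides k;
   so a factorisation of the quotient is an identity between multisets of
   integers. Telescoping [m] = [m]! / [m-1]!, it reads: a forest of size a_n
   is decomposed by removing the root of a tree (m to m - 1, once for each
   vertex) or by splitting a forest in two (m + k to m and k, once for each
   q-binomial). These moves decrease sizes, so treating the largest size first
   performs all of them, and running them backwards builds the tree. *)
Require Import Defs.
From mathcomp Require Import all_boot all_order all_algebra all_field.
From mathcomp Require Import zify.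

Set Implicit Arguments.
Unset Strict Implicit.
Unset Printing Implicit Defensive.

Lemma bigmax_seq_mem (s : seq nat) : s != [::] -> \max_(i <- s) i \in s.
Proof.
case: s => // x s _; elim: s x => [|y s IHs] x; first by rewrite big_seq1 mem_head.
rewrite big_cons; case: (leqP x (\max_(j <- y :: s) j)) => _.
  by rewrite inE IHs orbT.
by rewrite mem_head.
Qed.

(** * Forests and their trees *)

(** Unions are binary, so that one [Union] matches one q-binomial and one [Node] one vertex, hence
    one factor [d(v) + 1]. *)
Inductive forest :=
  | Empty
  | Node of forest
  | Union of forest & forest.

Fixpoint forest_size (f : forest) : nat :=
  match f with
  | Empty => 0
  | Node g => (forest_size g).+1
  | Union g h => forest_size g + forest_size h
  end.

Fixpoint subtree_sizes (f : forest) : seq nat :=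
  match f with
  | Empty => [::]
  | Node g => (forest_size g).+1 :: subtree_sizes g
  | Union g h => subtree_sizes g ++ subtree_sizes h
  end.

Fixpoint pos (f : forest) : finType :=
  match f with
  | Empty => void
  | Node g => option (pos g)
  | Union g h => (pos g + pos h)%type
  end.

(* [None] stands for a root added above the forest. This makes
   [option (pos f)], the vertices of the resulting tree, convertible to
   [pos (Node f)]. *)
Fixpoint pos_parent (f : forest) : pos f -> option (pos f) :=
  match f return pos f -> option (pos f) with
  | Empty => fun _ => None
  | Node g => omap (@pos_parent g)
  | Union g h => fun x =>
      match x with
      | inl y => omap inl (pos_parent y)
      | inr y => omap inr (pos_parent y)
      end
  end.

Definition tree_parent (f : forest) : option (pos f) -> option (pos f) :=
  obind (@pos_parent f).

(* [pos_below w v] says that v is w or an ancestor of w. *)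
Fixpoint pos_below (f : forest) : rel (pos f) :=
  match f return rel (pos f) with
  | Empty => fun _ _ => true
  | Node g => fun x y =>
      match x, y with
      | _, None => true
      | None, Some _ => false
      | Some x', Some y' => pos_below x' y'
      end
  | Union g h => fun x y =>
      match x, y with
      | inl x', inl y' => pos_below x' y'
      | inr x', inr y' => pos_below x' y'
      | _, _ => false
      end
  end.

(** A step of [f] need only become a path of [g]: a root is fixed by its own parent map, but its
    image in a larger tree may move on. *)
Lemma fconnect_homo (T U : finType) (f : T -> T) (g : U -> U) (h : T -> U) x y :
    (forall z, fconnect g (h z) (h (f z))) ->
  fconnect f x y -> fconnect g (h x) (h y).
Proof.
move=> hom /iter_findex <-; elim: (findex f x y) => [|k IHk]; first exact: connect0.
exact: connect_trans IHk (hom _).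
Qed.

Lemma pos_below_refl f : reflexive (@pos_below f).
Proof. by elim: f => //= [f IHf [x|]|f IHf g IHg [x|x]] //=; rewrite (IHf, IHg). Qed.

Lemma pos_below_trans f : transitive (@pos_below f).
Proof.
elim: f => [|f IHf|f IHf g IHg] //.
  by move=> [y|] [x|] [z|] //=; apply: IHf.
by move=> [y|y] [x|x] [z|z] //=; [apply: IHf | apply: IHg].
Qed.

Lemma pos_below_parent f (x : pos f) :
  @pos_below (Node f) (Some x) (pos_parent x).
Proof.
elim: f x => [|f IHf|f IHf g IHg] //= [x|] //=.
- exact: IHf.
- by move: (IHf x) => /=; case: (pos_parent x).
- by move=> x; move: (IHg x) => /=; case: (pos_parent x).
Qed.

(** Left to right, by transitivity along the iterates; right to left, by induction on the forest,
    carrying paths from smaller trees into larger ones. *)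
Lemma tree_parent_connect f (x y : option (pos f)) :
  fconnect (@tree_parent f) x y = @pos_below (Node f) x y.
Proof.
apply/idP/idP.
  move=> /iter_findex <-; elim: (findex _ x y) => [|k IHk]; first exact: pos_below_refl.
  apply: pos_below_trans IHk _ => /=; case: (iter _ _ _) => //= z.
  exact: pos_below_parent.
elim: f x y => [|f IHf|f IHf g IHg].
- by move=> [[]|] [[]|] _; apply: connect0.
- have homS z : fconnect (@tree_parent (Node f)) (Some z) (Some (@tree_parent f z)).
    by case: z => [z|] /=; [exact: fconnect1 | exact: connect0].
  have toS x : fconnect (@tree_parent (Node f)) (Some x) (Some None).
    by apply: (fconnect_homo homS); apply: IHf; case: x.
  move=> [x|] [[y|]|] //=.
  + by case: x => // x xy; apply: (fconnect_homo homS); apply: IHf.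
  + by move=> _; apply: connect_trans (toS x) _; apply: fconnect1.
- have homl z : fconnect (@tree_parent (Union f g)) (omap inl z)
      (omap inl (@tree_parent f z)).
    by case: z => [z|] /=; [exact: fconnect1 | exact: connect0].
  have homr z : fconnect (@tree_parent (Union f g)) (omap inr z)
      (omap inr (@tree_parent g z)).
    by case: z => [z|] /=; [exact: fconnect1 | exact: connect0].
  move=> [[x|x]|] [[y|y]|] //= xy; try exact: connect0.
  + by apply: (fconnect_homo (x := Some x) (y := Some y) homl); apply: IHf.
  + by apply: (fconnect_homo (x := Some x) (y := None) homl); apply: IHf.
  + by apply: (fconnect_homo (x := Some x) (y := Some y) homr); apply: IHg.
  + by apply: (fconnect_homo (x := Some x) (y := None) homr); apply: IHg.
Qed.

Lemma tree_parent_connect_root f (x : option (pos f)) :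
  fconnect (@tree_parent f) x None.
Proof. by rewrite tree_parent_connect; case: x. Qed.

Definition tree_of (f : forest) : rtree :=
  RTree (erefl : @tree_parent f None = None) (@tree_parent_connect_root f).

Lemma codom_option (T : finType) (S : Type) (F : option T -> S) :
  codom F = F None :: codom (fun x => F (Some x)).
Proof.
by rewrite !codomE !enumT [in LHS]unlock /= /option_enum -map_comp.
Qed.

Lemma codom_sum (T U : finType) (S : Type) (F : T + U -> S) :
  codom F = codom (fun x => F (inl x)) ++ codom (fun x => F (inr x)).
Proof.
by rewrite !codomE !enumT [in LHS]unlock /= /sum_enum map_cat -!map_comp.
Qed.

Lemma card_pos f : #|pos f| = forest_size f.
Proof.
elim: f => [|f IHf|f IHf g IHg] /=; first exact: card_void.
  by rewrite card_option IHf.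
by rewrite card_sum IHf IHg.
Qed.

(** The sequences agree without permutation because option and sum types are enumerated in the order
    of [subtree_sizes]. *)
Lemma codom_card_below f :
  codom (fun v : pos f => #|[pred w | pos_below w v]|) = subtree_sizes f.
Proof.
elim: f => [|f IHf|f IHf g IHg] /=.
- by rewrite codomE; apply: size0nil; rewrite size_map -cardT card_void.
- rewrite codom_option -card_pos -card_option; congr (_ :: _).
    by apply: eq_card => -[].
  rewrite -IHf; apply: eq_codom => v.
  rewrite -[RHS](card_image (@Some_inj _)).
  apply: eq_card => -[w|]; rewrite !inE; last by apply/esym/imageP => -[].
  by rewrite (mem_image (@Some_inj _)).
- have inl_inj : injective (@inl (pos f) (pos g)) by move=> ? ? [].
  have inr_inj : injective (@inr (pos f) (pos g)) by move=> ? ? [].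
  rewrite codom_sum -IHf -IHg; congr (_ ++ _); apply: eq_codom => v.
    rewrite -[RHS](card_image inl_inj); apply: eq_card => -[w|w]; rewrite !inE.
      by rewrite (mem_image inl_inj).
    by apply/esym/imageP => -[].
  rewrite -[RHS](card_image inr_inj); apply: eq_card => -[w|w]; rewrite !inE.
    by apply/esym/imageP => -[].
  by rewrite (mem_image inr_inj).
Qed.

(** A subtree size counts the top vertex, [descendants] does not; hence [S]. *)
Lemma descendant_counts_tree_of f :
  map S (descendant_counts (tree_of f)) = subtree_sizes (Node f).
Proof.
rewrite -codom_card_below -map_comp; apply: eq_map => v /=.
rewrite [RHS](cardD1 v) (_ : v \in _ = true) ?add1n; last exact: (@pos_below_refl (Node f)).
by congr _.+1; apply: eq_card => w; rewrite !inE tree_parent_connect.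
Qed.

(** * Building forests from a multiset identity *)

Lemma iota1_rcons m : iota 1 m.+1 = rcons (iota 1 m) m.+1.
Proof. by rewrite -{1}(addn1 m) iotaD cats1 add1n. Qed.

Lemma mem_iota1 i m : (i \in iota 1 m) = (0 < i <= m).
Proof. by rewrite mem_iota add1n ltnS. Qed.

Lemma perm_flatten_map (T : eqType) (S : eqType) (F : T -> seq S) (s t : seq T) :
  perm_eq s t -> perm_eq (flatten (map F s)) (flatten (map F t)).
Proof. by move=> st; apply/perm_flatten/perm_map. Qed.

Lemma perm_map_consP (T : Type) (S : eqType) (F : T -> S) (s : seq T) x (t : seq S) :
    perm_eq (map F s) (x :: t) ->
  exists s1 y s2, [/\ s = s1 ++ y :: s2, F y = x & perm_eq (map F (s1 ++ s2)) t].
Proof.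
move=> st; have [s1 [y [s2 [eq_s Fy]]]] :
    exists s1 y s2, s = s1 ++ y :: s2 /\ F y = x.
  have : x \in map F s by rewrite (perm_mem st) mem_head.
  elim: s {st} => //= z s IHs; rewrite inE => /orP[/eqP->|/IHs].
    by exists [::], z, s.
  by move=> [s1 [y [s2 [-> <-]]]]; exists (z :: s1), y, s2.
exists s1, y, s2; split=> //.
by rewrite -(perm_cons x) -(permPr st) eq_s !map_cat /= Fy perm_sym
  -(cat1s x (map F s2)) perm_catCA.
Qed.

(* L lists the sizes of the forests still to be built, c the sizes of their
   subtrees, and s the pairs of sizes to be merged. The largest size M among
   the subtrees and the merged forests has to occur in L, since the pairs in s
   have smaller members: a forest of size M is built as a tree if M is in c,
   and as a union if M is a merged size. *)
Lemma forests_of_perm (L c : seq nat) (s : seq (nat * nat)) :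
    all (leq 1) c ->
    perm_eq (flatten (map (iota 1) L)
             ++ flatten [seq iota 1 mk.1 ++ iota 1 mk.2 | mk <- s])
            (c ++ flatten [seq iota 1 (mk.1 + mk.2) | mk <- s]) ->
  exists2 fs : seq forest, perm_eq (map forest_size fs) L
    & perm_eq (flatten (map subtree_sizes fs)) c.
Proof.
(* Each move uses up one entry of [c] or one pair of [s]. *)
have [k] := ubnP (size c + size s); elim: k L c s => // k IH L c s /ltnSE size_le c1.
(* A pair with a zero member contributes the same to both sides and is dropped; the remaining pairs
   have members smaller than their sum. *)
have trivial_pair mk : mk \in s -> perm_eq (iota 1 mk.1 ++ iota 1 mk.2)
    (iota 1 (mk.1 + mk.2)) ->
  perm_eq (flatten (map (iota 1) L)
             ++ flatten [seq iota 1 mk.1 ++ iota 1 mk.2 | mk <- s])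
            (c ++ flatten [seq iota 1 (mk.1 + mk.2) | mk <- s]) ->
  exists2 fs : seq forest, perm_eq (map forest_size fs) L
    & perm_eq (flatten (map subtree_sizes fs)) c.
  move=> mk_s mk0 eq_cs; apply: (IH L c (rem mk s)) => //.
    by rewrite size_rem //; case: (s) mk_s size_le => //= ? ?; rewrite addnS.
  move: eq_cs; have s_mk := perm_to_rem mk_s.
  have := perm_flatten_map (fun mk => iota 1 mk.1 ++ iota 1 mk.2) s_mk.
  have := perm_flatten_map (fun mk => iota 1 (mk.1 + mk.2)) s_mk.
  move: mk0 => /permP mk0 /permP s2 /permP s1 /permP eq_cs; apply/permP => p.
  move: (mk0 p) (s1 p) (s2 p) (eq_cs p); rewrite /= !count_cat; lia.
have [/hasP[[m l] ml_s /= /orP[]/eqP z]|/hasPn s_nz] :=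
    boolP (has (fun mk => (mk.1 == 0) || (mk.2 == 0)) s).
- by apply: trivial_pair ml_s _; rewrite /= z.
- by apply: trivial_pair ml_s _; rewrite /= z addn0 cats0.
move=> {trivial_pair} eq_cs.
pose M := \max_(i <- c ++ [seq mk.1 + mk.2 | mk <- s]) i.
have le_M i : i \in c ++ [seq mk.1 + mk.2 | mk <- s] -> i <= M.
  by move=> i_in; apply: (@leq_bigmax_seq _ _ predT (fun j => j) i i_in isT).
(* With nothing left to build, every entry of [L] must be 0. *)
have [nil_cs|] := eqVneq (c ++ [seq mk.1 + mk.2 | mk <- s]) [::].
  have c0 : c = [::] by case: (c) nil_cs.
  have s0 : s = [::] by move: nil_cs; rewrite c0; case: (s).
  exists [seq Empty | _ <- L]; last first.
    by rewrite c0; elim: (L).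
  move: eq_cs; rewrite c0 s0 /= cats0 => /perm_nilP.
  by elim: (L) => //= -[|l] L' IHL //= /IHL; rewrite perm_cons.
move=> /bigmax_seq_mem; rewrite -/M => M_cs.
have M_gt0 : 0 < M.
  move: M_cs; rewrite mem_cat => /orP[/(allP c1)//|/mapP[mk mk_s ->]].
  by have := s_nz _ mk_s; rewrite /=; lia.
have s_lt (mk : nat * nat) : mk \in s -> (mk.1 < M) && (mk.2 < M).
  move=> mk_s; have : mk.1 + mk.2 <= M.
    by apply: le_M; rewrite mem_cat (map_f (fun mk => mk.1 + mk.2)) ?orbT.
  have := s_nz _ mk_s; rewrite /=; lia.
have M_rhs : M \in c ++ flatten [seq iota 1 (mk.1 + mk.2) | mk <- s].
  move: M_cs; rewrite !mem_cat => /orP[->//|/mapP[mk mk_s M_eq]].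
  apply/orP; right; apply/flatten_mapP; exists mk => //.
  by rewrite mem_iota1 M_gt0 M_eq /=.
have rhs_le i : i \in c ++ flatten [seq iota 1 (mk.1 + mk.2) | mk <- s] -> i <= M.
  rewrite mem_cat => /orP[i_c|/flatten_mapP[mk mk_s]].
    by apply: le_M; rewrite mem_cat i_c.
  rewrite mem_iota1 => /andP[_ i_le]; apply: leq_trans i_le (le_M _ _).
  by rewrite mem_cat (map_f (fun mk => mk.1 + mk.2)) ?orbT.
have M_L : M \in L.
  move: M_rhs; rewrite -(perm_mem eq_cs) mem_cat => /orP[/flatten_mapP[l l_L]|].
    rewrite mem_iota1 => /andP[_ M_le]; suff -> : M = l by [].
    apply/eqP; rewrite eqn_leq M_le /=; apply: rhs_le.
    rewrite -(perm_mem eq_cs) mem_cat; apply/orP; left.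
    by apply/flatten_mapP; exists l; rewrite // mem_iota1 leqnn andbT; lia.
  case/flatten_mapP => mk mk_s; rewrite mem_cat !mem_iota1.
  have /andP[] := s_lt _ mk_s; rewrite !(ltnNge _ M) => /negPf-> /negPf->.
  by rewrite !andbF.
have L_M := perm_to_rem M_L.
have /permP L_iota := perm_flatten_map (iota 1) L_M.
move: M_cs; rewrite mem_cat => /orP[M_c|/mapP[mk mk_s M_eq]].
- have c_M := perm_to_rem M_c.
  have [||| fs] := IH (M.-1 :: rem M L) (rem M c) s.
  + by rewrite size_rem //; case: (c) M_c size_le.
  + by apply/allP => i /mem_rem; apply: (allP c1).
  + move: eq_cs c_M => /permP eq_cs /permP c_M; apply/permP => p.
    move: (eq_cs p) (L_iota p) (c_M p); rewrite /=.
    have -> : iota 1 M = rcons (iota 1 M.-1) M.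
      by rewrite -{1}(prednK M_gt0) iota1_rcons prednK.
    rewrite -cats1 !count_cat /=; lia.
  move=> fsL fsc.
  have [s1 [f [s2 [eq_fs f_size fsL']]]] := perm_map_consP fsL.
  have f_sizeS : (forest_size f).+1 = M by rewrite f_size prednK.
  exists (Node f :: s1 ++ s2); rewrite /= f_sizeS.
  + by rewrite (permPr L_M) perm_cons.
  + rewrite (permPr c_M) perm_cons -(permPr fsc) eq_fs !map_cat !flatten_cat /=.
    by rewrite perm_catCA.
- have s_mk := perm_to_rem mk_s.
  have [||| fs] := IH (mk.1 :: mk.2 :: rem M L) c (rem mk s).
  + by rewrite size_rem //; case: (s) mk_s size_le => //= ? ?; rewrite addnS.
  + by [].
  + move: eq_cs => /permP eq_cs; apply/permP => p.
    have /permP/(_ p) := perm_flatten_map (fun mk => iota 1 mk.1 ++ iota 1 mk.2) s_mk.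
    have /permP/(_ p) := perm_flatten_map (fun mk => iota 1 (mk.1 + mk.2)) s_mk.
    move: (eq_cs p) (L_iota p); rewrite /= -M_eq !count_cat; lia.
  move=> fsL fsc.
  have [s1 [f [s2 [eq_fs f_size fsL']]]] := perm_map_consP fsL.
  have [s3 [g [s4 [eq_fs' g_size fsL'']]]] := perm_map_consP fsL'.
  exists (Union f g :: s3 ++ s4); rewrite /= ?f_size ?g_size -?M_eq.
  + by rewrite (permPr L_M) perm_cons.
  + rewrite -(permPr fsc) eq_fs.
    have /permP eq_flat : perm_eq (flatten (map subtree_sizes (s1 ++ s2)))
        (flatten (map subtree_sizes (s3 ++ g :: s4))) by rewrite eq_fs'.
    apply/permP => p; move: (eq_flat p).
    rewrite /= !map_cat !flatten_cat /= !count_cat; lia.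
Qed.

Import GRing.Theory.
Local Open Scope ring_scope.

(** * Multiplicative independence of the q-numbers *)

(** A polynomial form of [qnum], in which roots of unity can be substituted. *)
Definition qnum_poly (m : nat) : {poly rat} := \sum_(i < m) 'X^i.

Lemma one_sub_q_neq0 : 1 - q != 0.
Proof.
rewrite subr_eq0 -tofrac1 tofrac_eq eq_sym; apply/eqP => /(congr1 (horner^~ 0)).
by rewrite hornerX hornerC => /eqP; rewrite eq_sym oner_eq0.
Qed.

Lemma qnumE m : qnum m = tofrac (qnum_poly m).
Proof.
apply: (canLR (mulfK one_sub_q_neq0)).
rewrite -opprB subrX1 -mulNr opprB mulrC; congr (_ * _).
by rewrite raddf_sum; apply: eq_bigr => i _; rewrite -tofracXn.
Qed.

Lemma qnum_neq0 m : (0 < m)%N -> qnum m != 0.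
Proof.
move=> m_gt0; rewrite qnumE tofrac_eq0; apply/eqP => /(congr1 (horner^~ 1)).
rewrite horner_sum horner0; under eq_bigr do rewrite hornerXn expr1n.
by rewrite sumr_const card_ord => /eqP; rewrite Num.Theory.pnatr_eq0; case: m m_gt0.
Qed.

Lemma qfactE m : qfact m = \prod_(i <- iota 1 m) qnum i.
Proof. by rewrite /qfact /index_iota subn1. Qed.

Lemma prod_qnum_neq0 (s : seq nat) :
  all (leq 1) s -> \prod_(i <- s) qnum i != 0.
Proof.
move=> /allP s_gt0; rewrite prodf_seq_neq0; apply/allP => i /s_gt0.
exact: qnum_neq0.
Qed.

Lemma iota1_gt0 m : all (leq 1) (iota 1 m).
Proof. by apply/allP => i; rewrite mem_iota => /andP[]. Qed.

Lemma qfact_neq0 m : qfact m != 0.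
Proof. by rewrite qfactE prod_qnum_neq0 // iota1_gt0. Qed.

Lemma qfactS m : qfact m.+1 = qfact m * qnum m.+1.
Proof. by rewrite /qfact big_nat_recr. Qed.

(* Evaluation at a primitive m-th root of unity. *)
Lemma eq_prod_qnum_dvd (s t : seq nat) m :
    (1 < m)%N -> m \in s ->
    \prod_(i <- s) qnum i = \prod_(i <- t) qnum i ->
  exists2 k, k \in t & (m %| k)%N.
Proof.
move=> m_gt1 m_s; have [z zP] := C_prim_root_exists (ltnW m_gt1).
have z_neq1 : z - 1 != 0.
  rewrite subr_eq0; apply/eqP => z1.
  by have := prim_order_dvd zP 1; rewrite expr1 z1 eqxx dvdn1; case: eqP m_gt1 => // ->.
(* Multiplying by [z - 1] turns the value of [k] at [z] into [z ^+ k - 1]. *)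
have rootE k : ((map_poly ratr (qnum_poly k)).[z] == 0) = (m %| k)%N.
  rewrite -(inj_eq (mulfI z_neq1)) mulr0 (prim_order_dvd zP).
  rewrite -[RHS]subr_eq0 subrX1; congr (_ * _ == 0).
  rewrite rmorph_sum horner_sum; apply: eq_bigr => i _.
  by rewrite rmorphXn /= map_polyX hornerXn.
rewrite !(eq_bigr _ (fun i _ => qnumE i)).
rewrite -!rmorph_prod => /eqP; rewrite tofrac_eq => /eqP.
move=> /(congr1 (fun p => (map_poly (ratr : rat -> algC) p).[z])).
rewrite !rmorph_prod !horner_prod (big_rem m) //= => /esym/eqP.
have /eqP -> : (map_poly ratr (qnum_poly m)).[z] == 0 by rewrite rootE.
rewrite mul0r prodf_seq_eq0 => /hasP[k k_t /=].
by rewrite rootE; exists k.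
Qed.

(** If the maximum of [s] is at least 2, it divides an entry of [t]. The factor [1] = 1 leaves no
    trace in a product; in that case the equal sizes ensure that [t] is nonempty. *)
Lemma eq_prod_qnum_max (s t : seq nat) :
    all (leq 1) s -> all (leq 1) t -> size s = size t ->
    \prod_(i <- s) qnum i = \prod_(i <- t) qnum i ->
  (\max_(i <- s) i <= \max_(i <- t) i)%N.
Proof.
move=> s1 /allP t1 eq_size eq_st.
have [->|sn0] := eqVneq s [::]; first by rewrite big_nil.
have tn0 : t != [::] by rewrite -size_eq0 -eq_size size_eq0.
have [max_le1|max_gt1] := leqP (\max_(i <- s) i) 1.
  exact: leq_trans max_le1 (t1 _ (bigmax_seq_mem tn0)).
have [i i_t max_i] := eq_prod_qnum_dvd max_gt1 (bigmax_seq_mem sn0) eq_st.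
apply: leq_trans (leq_bigmax_seq _ i_t isT).
by rewrite dvdn_leq // t1.
Qed.

(** The maxima agree, so their factors cancel, and induction treats the rest. *)
Lemma eq_prod_qnum_perm (s t : seq nat) :
    all (leq 1) s -> all (leq 1) t -> size s = size t ->
    \prod_(i <- s) qnum i = \prod_(i <- t) qnum i ->
  perm_eq s t.
Proof.
have [k] := ubnP (size s); elim: k s t => // k IH s t /ltnSE s_le s1 t1 eq_size eq_st.
have [s0|sn0] := eqVneq s [::].
  by have /eqP : size t = 0%N by [rewrite -eq_size s0]; rewrite s0 size_eq0 => /eqP->.
have tn0 : t != [::] by rewrite -size_eq0 -eq_size size_eq0.
have le_st := eq_prod_qnum_max s1 t1 eq_size eq_st.
have le_ts := eq_prod_qnum_max t1 s1 (esym eq_size) (esym eq_st).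
have := bigmax_seq_mem sn0; have := bigmax_seq_mem tn0.
have -> : (\max_(i <- t) i = \max_(i <- s) i)%N by apply/eqP; rewrite eqn_leq le_ts.
move: (\max_(i <- s) i)%N => m m_t m_s.
rewrite (permPl (perm_to_rem m_s)) perm_sym (permPl (perm_to_rem m_t)) perm_cons perm_sym.
apply: IH.
- by rewrite size_rem //; case: (s) m_s s_le.
- by apply/allP => i /mem_rem; move/allP: s1; apply.
- by apply/allP => i /mem_rem; move/allP: t1; apply.
- by rewrite !size_rem // eq_size.
apply: (mulfI (qnum_neq0 (allP s1 _ m_s))).
by move: eq_st; rewrite (big_rem m m_s) (big_rem m m_t).
Qed.

(** * Products of q-binomials *)

Lemma is_qbinom_productM x y :
  is_qbinom_product x -> is_qbinom_product y -> is_qbinom_product (x * y).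
Proof. by move=> [s ->] [t ->]; exists (s ++ t); rewrite big_cat. Qed.

Lemma is_qbinom_product_qbinom m k : is_qbinom_product (qbinom m k).
Proof. by exists [:: (m, k)]; rewrite big_seq1. Qed.

(** * Descendants in a rooted tree *)

Section RootedTree.
Variable T : rtree.
Implicit Types (v w : vertex T) (S : {set vertex T}).

Lemma iter_parent_root k : iter k (@parent T) (Defs.root T) = Defs.root T.
Proof. by elim: k => //= k ->; apply: parent_root. Qed.

(** A cycle brings [v] back to itself after arbitrarily many steps, yet iteration ends at the root;
    so [v] is the root, which is fixed. *)
Lemma fconnect_parent_anti v w :
  fconnect (@parent T) v w -> fconnect (@parent T) w v -> v = w.
Proof.
move=> /iter_findex; set i := findex _ v w => vw /iter_findex; set j := findex _ w v => wv.
have [i0|i_gt0] := posnP i; first by rewrite -vw i0.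
have /iter_findex := parent_connect v; set k := findex _ v _ => v_root.
have period l : iter (l * (j + i)) (@parent T) v = v.
  by elim: l => // l IHl; rewrite mulSn iterD IHl iterD vw wv.
have v_eq : v = Defs.root T.
  rewrite -(period k) -(subnK (_ : k <= k * (j + i))%N) ?iterD ?v_root ?iter_parent_root //.
  by rewrite leq_pmulr // addn_gt0 i_gt0 orbT.
by rewrite -vw v_eq iter_parent_root.
Qed.

Lemma fconnect_parent_total v w x :
    fconnect (@parent T) x v -> fconnect (@parent T) x w ->
  fconnect (@parent T) v w || fconnect (@parent T) w v.
Proof.
move=> /iter_findex <- /iter_findex <-.
move: (findex _ x v) (findex _ x w) => i j.
by case/orP: (leq_total i j) => /subnK <-; rewrite iterD fconnect_iter ?orbT.
Qed.

Lemma descendants_proper v w :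
  w \in descendants v -> (#|descendants w| < #|descendants v|)%N.
Proof.
rewrite inE => /andP[w_neq wv]; apply: proper_card; apply/properP; split.
  apply/subsetP => x; rewrite !inE => /andP[x_neq xw].
  rewrite (connect_trans xw wv) andbT; apply: contra_neq w_neq => xv.
  by apply: fconnect_parent_anti; rewrite // -xv.
by exists w; rewrite !inE ?eqxx ?w_neq.
Qed.

(** Such sets are unions of full subtrees, that is, forests with any number of roots. *)
Definition down_closed S := forall v, v \in S -> descendants v \subset S.

Lemma down_closed_descendants v : down_closed (descendants v).
Proof.
move=> w w_v; apply/subsetP => x x_w.
have := descendants_proper w_v; rewrite ltnNge.
move: w_v x_w; rewrite !inE => /andP[w_neq wv] /andP[x_neq xw].
rewrite (connect_trans xw wv) andbT; case: eqVneq => // xv.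
by rewrite (fconnect_parent_anti wv _) ?eqxx // -xv in w_neq.
Qed.

(* The subtree of a vertex of S with most descendants splits off S: when it is
   all of S, removing its root cancels a factor; otherwise it and its
   complement are both down-closed, which costs one q-binomial. *)
Lemma qfact_div_down_closed S : down_closed S ->
  is_qbinom_product (qfact #|S| / \prod_(w in S) qnum #|descendants w|.+1).
Proof.
have [k] := ubnP #|S|; elim: k S => // k IH S /ltnSE card_le S_closed.
have [->|[v0 v0_S]] := set_0Vmem S.
  by exists [::]; rewrite cards0 /qfact big_geq // big_set0 divr1 big_nil.
case: (arg_maxnP (fun w => #|descendants w|) v0_S) => v v_S' v_max.
have v_S : v \in S by exact: v_S'.
have v_desc : v \notin descendants v by rewrite inE eqxx.
set A := v |: descendants v.
have cardA : #|A| = #|descendants v|.+1 by rewrite cardsU1 v_desc.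
have A_S : A \subset S by rewrite subUset sub1set v_S S_closed.
have prodA : \prod_(w in A) qnum #|descendants w|.+1
    = qnum #|A| * \prod_(w in descendants v) qnum #|descendants w|.+1.
  by rewrite big_setU1 // cardA.
(* The factor of [v] cancels the last factor of the factorial, and induction applies to the vertices
   below [v]. *)
have divA : is_qbinom_product (qfact #|A| / \prod_(w in A) qnum #|descendants w|.+1).
  have := IH _ _ (@down_closed_descendants v).
  rewrite prodA cardA qfactS invfM mulrA mulfK ?qnum_neq0 //; apply.
  by rewrite -cardA; apply: leq_trans (subset_leq_card A_S) card_le.
have [->|AneqS] := eqVneq S A; first exact: divA.
(* A vertex [w] of [S] outside [A] with a descendant in [A] would be comparable with [v], hence
   above [v], against the choice of [v]. *)
have SA_closed : down_closed (S :\: A).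
  move=> w; rewrite inE => /andP[w_A w_S]; apply/subsetP => x x_w.
  rewrite inE (subsetP (S_closed _ w_S)) // andbT.
  apply: contra w_A => x_A.
  have xv : fconnect (@parent T) x v.
    by move: x_A; rewrite !inE => /orP[/eqP->|/andP[]//]; apply: connect0.
  have xw : fconnect (@parent T) x w by move: x_w; rewrite inE => /andP[].
  have [->|w_neq] := eqVneq w v; first by rewrite !inE eqxx.
  have /orP[vw|wv] := fconnect_parent_total xv xw; last by rewrite !inE w_neq wv orbT.
  have /descendants_proper : v \in descendants w by rewrite inE eq_sym w_neq.
  by rewrite ltnNge => /negP[]; apply: v_max.
have cardS : #|S| = (#|A| + #|S :\: A|)%N.
  by rewrite -(cardsID A S) (setIidPr A_S).
rewrite [X in is_qbinom_product X](_ : _ = qbinom #|A| #|S :\: A| *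
    ((qfact #|A| / \prod_(w in A) qnum #|descendants w|.+1) *
     (qfact #|S :\: A| / \prod_(w in S :\: A) qnum #|descendants w|.+1))); last first.
  rewrite (big_setID A) (setIidPr A_S) /= /qbinom -cardS mulf_div mulrA.
  by rewrite divfK // mulf_neq0 ?qfact_neq0.
apply: is_qbinom_productM (is_qbinom_product_qbinom _ _) _.
apply: is_qbinom_productM divA (IH _ _ SA_closed).
apply: leq_trans card_le; rewrite cardS cardA; lia.
Qed.

Lemma descendants_root : descendants (Defs.root T) = ~: [set Defs.root T].
Proof. by apply/setP => w; rewrite !inE parent_connect andbT. Qed.

Lemma perm_descendant_counts :
  perm_eq (descendant_counts T)
    (#|vertex T|.-1 :: [seq #|descendants w| | w in descendants (Defs.root T)]).
Proof.
have card_root : #|descendants (Defs.root T)| = #|vertex T|.-1.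
  by rewrite descendants_root cardsC1.
rewrite -card_root -(map_cons (fun w => #|descendants w|)) perm_map //.
apply: uniq_perm.
- exact: enum_uniq.
- by rewrite /= enum_uniq mem_enum inE eqxx.
by move=> w; rewrite inE !mem_enum descendants_root !inE orbN.
Qed.

End RootedTree.

(** * The two implications *)

Lemma descendant_counts_qbinom_product (T : rtree) (s : seq nat) :
    perm_eq (descendant_counts T) (#|vertex T|.-1 :: s) ->
  is_qbinom_product (qfact #|vertex T|.-1 / \prod_(i <- s) qnum i.+1).
Proof.
rewrite (permPl (perm_descendant_counts T)) perm_cons => /(perm_big _) <-.
rewrite big_map big_enum /=.
have -> : #|vertex T|.-1 = #|descendants (Defs.root T)|.
  by rewrite descendants_root cardsC1.
exact: qfact_div_down_closed (@down_closed_descendants _ _).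
Qed.

(** Clearing denominators gives an identity between products of q-numbers; independence turns it
    into the hypothesis of [forests_of_perm], with a single forest to build. *)
Lemma qbinom_product_forest (s : seq nat) :
    is_qbinom_product (qfact (size s) / \prod_(i <- s) qnum i.+1) ->
  exists2 f, forest_size f = size s & perm_eq (subtree_sizes f) (map S s).
Proof.
have s_neq0 : \prod_(i <- s) qnum i.+1 != 0.
  by rewrite -(big_map S predT) prod_qnum_neq0 //; apply/allP => _ /mapP[i _ ->].
move=> [t /(canRL (divfK s_neq0)) eq_t].
have prod_flatten (F : nat * nat -> seq nat) :
    \prod_(i <- flatten (map F t)) qnum i = \prod_(mk <- t) \prod_(i <- F mk) qnum i.
  by rewrite big_flatten big_map.
have gt0_flatten (F : nat * nat -> seq nat) : (forall mk, all (leq 1) (F mk)) ->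
    all (leq 1) (flatten (map F t)).
  by move=> F1; elim: (t) => //= mk t' IHt; rewrite all_cat F1.
have perm_t := @eq_prod_qnum_perm
  (iota 1 (size s) ++ flatten [seq iota 1 mk.1 ++ iota 1 mk.2 | mk <- t])
  (map S s ++ flatten [seq iota 1 (mk.1 + mk.2) | mk <- t]).
have [||fs fs_size fs_sizes] := @forests_of_perm [:: size s] (map S s) t.
- by apply/allP => _ /mapP[i _ ->].
- have -> : flatten [seq iota 1 i | i <- [:: size s]] = iota 1 (size s).
    by rewrite /= cats0.
  apply: perm_t.
  + rewrite all_cat iota1_gt0 gt0_flatten // => mk.
    by rewrite all_cat !iota1_gt0.
  + rewrite all_cat gt0_flatten ?andbT => [|mk]; last exact: iota1_gt0.
    by apply/allP => _ /mapP[i _ ->].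
  (* The numbers of factors agree because the index of the factorial is the number of factors
     [i + 1] in the denominator. *)
  + rewrite !size_cat size_iota size_map; congr (_ + _)%N.
    elim: (t) => //= mk t' IHt.
    by rewrite !size_cat !size_iota IHt.
  rewrite !big_cat /= !prod_flatten -qfactE eq_t big_map mulrAC mulrC.
  congr (_ * _); rewrite -big_split /=; apply: eq_bigr => mk _.
  by rewrite big_cat /= -!qfactE /qbinom divfK // mulf_neq0 ?qfact_neq0.
have /perm_small_eq := fs_size.
case: fs fs_size fs_sizes => [|f [|? ?]] _ //=; rewrite ?cats0 => fs_sizes /(_ isT) // [f_size].
by exists f.
Qed.

(* The tuple a_1 <= ... <= a_n is indexed from 0: a_i is [nth 0 a i.-1], so
   a_1, ..., a_(n-1) are [nth 0 a i] for i < n.-1 and a_n is [last 0 a]. *)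
Theorem theorem5p2 (n : nat) (a : n.-tuple nat)
    (n_gt0 : (0 < n)%N) (a_sorted : sorted leq a) :
  (exists T : rtree, perm_eq (descendant_counts T) a)
  <->
  (last 0%N a = n.-1 /\
   is_qbinom_product
     (qfact (last 0%N a) / \prod_(i < n.-1) qnum (nth 0%N a i).+1)).
Proof.
(* From here on the tuple has [n.+1] entries, and its last one has to be [n]. *)
case: n n_gt0 a a_sorted => // n _ a a_sorted /=.
pose s := belast (thead a) (behead a).
have a_rcons : a = rcons s (last 0%N a) :> seq nat.
  by case/tupleP: a @s {a_sorted} => x a s; rewrite /= /s theadE -lastI.
have size_s : size s = n by rewrite size_belast size_behead size_tuple.
have -> : \prod_(i < n) qnum (nth 0%N a i).+1 = \prod_(i <- s) qnum i.+1.
  rewrite (big_nth 0%N) size_s big_mkord; apply: eq_bigr => i _.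
  by rewrite a_rcons nth_rcons size_s ltn_ord.
have perm_a : perm_eq a (last 0%N a :: s) by rewrite {1}a_rcons perm_rcons.
split=> [[T T_a] | [a_last]].
  have card_T : #|vertex T| = n.+1.
    by rewrite -(size_tuple a) -(perm_size T_a) size_map -cardT.
  (* The root has count [n], and no vertex has more descendants than there are other vertices. *)
  have a_last : last 0%N a = n.
    have le_last i : i \in (a : seq nat) -> (i <= last 0%N a)%N.
      move: a_sorted a_rcons; move: (last 0%N a) => l + a_rcons; rewrite a_rcons.
      rewrite -cats1 (sorted_pairwise leq_trans) pairwise_cat.
      rewrite mem_cat mem_seq1 => /and3P[/allrelP sl _ _] /orP[i_s|/eqP->//].
      by apply: sl => //; rewrite mem_head.
    have n_a : n \in (a : seq nat).
      rewrite -(perm_mem T_a) (perm_mem (perm_descendant_counts T)) card_T.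
      exact: mem_head.
    apply/eqP; rewrite eqn_leq (le_last _ n_a) andbT.
    have : last 0%N a \in (a : seq nat) by rewrite (perm_mem perm_a) mem_head.
    rewrite -(perm_mem T_a) => /mapP[v _ ->].
    rewrite -ltnS -card_T -cardsT; apply: proper_card; apply/properP; split.
      exact: subsetT.
    by exists v; rewrite ?inE ?eqxx.
  split; rewrite // a_last -[n]/(n.+1.-1) -card_T.
  apply: descendant_counts_qbinom_product.
  by rewrite card_T /= -{1}a_last -(permPr perm_a).
rewrite a_last -[X in qfact X]size_s => /qbinom_product_forest[f f_size f_s].
(* The [n] vertices of [f] lie below an added root, whose count is the last entry. *)
exists (tree_of f); rewrite (permPr perm_a) a_last.
apply: (perm_map_inj succn_inj); rewrite descendant_counts_tree_of /= f_size size_s.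
by rewrite perm_cons.
Qed.
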